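(* Let $p,n,q\ge 1$ be integers and let $C\ge e$, $\sigma>0$. There exist constants $C',c>0$ depending only on $C$ and $q$ such that the following holds. Let $X,Y$ be two random matrices of size $p\times n$ and let $A$ be a deterministic real $p\times p$ matrix. If $(X,Y)\propto Ce^{-(\cdot/\sigma)^q}$ and $\mathbb E[X]=\mathbb E[Y]=0$, then $$X^TAY\ \in\ \mathbb E[X^TAY]\ \pm\ \left( C'\exp\left(-\left(\frac{\cdot}{c\,\sigma^2\|A\|_F\,\log(pn)^{1/q}}\right)^q\right)+C'\exp\left(-\left(\frac{\cdot}{c\,\|A\|_F\,\sigma^2}\right)^{q/2}\right)\right)$$ in $(\mathcal M_n,\|\cdot\|_F)$. The constants $C',c$ do not depend on $p,n,\sigma,X,Y,A$.
   Context: $\mathcal M_{p,n}$ is the space of real $p\times n$ matrices, $\mathcal M_n=\mathcal M_{n,n}$, and $\|\cdot\|_F$ is the Frobenius norm. The pair $(X,Y)$ is viewed as a random vector of $\mathcal M_{p,n}\times\mathcal M_{p,n}$ endowed with the norm $\|(x,y)\|=\sup(\|x\|_F,\|y\|_F)$. For a real random variable $W$ and a non-increasing $\alpha:\mathbb R_+\to\mathbb R_+$ (values above $1$ read as $1$): $W\propto\alpha$ means $\mathbb P(|W-W'|\ge t)\le\alpha(t)$ for all $t>0$, with $W'$ an independent copy of $W$; $W\in a\pm\alpha$ means $\mathbb P(|W-a|\ge t)\le\alpha(t)$ for all $t>0$. For a random vector $Z$ of a normed space $(V,\|\cdot\|)$: $Z\propto\alpha$ (Lipschitz concentration) means $f(Z)\propto\alpha$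 for every $1$-Lipschitz $f:V\to\mathbb R$; and $Z\in\tilde Z\pm\alpha$ in $(V,\|\cdot\|)$ (linear concentration around the deterministic vector $\tilde Z$) means $u(Z)\in u(\tilde Z)\pm\alpha$ for every linear form $u:V\to\mathbb R$ with $|u(z)|\le\|z\|$ for all $z\in V$. In $\alpha$, the dot stands for the argument $t$; a quotient $t/0$ with $t>0$ is read as $+\infty$ (and $e^{-\infty}=0$). *)

(* Defs.v *)
(* MathComp-Analysis, over an arbitrary real number structure R : realType. *)
From HB Require Import structures.
From mathcomp Require Import all_boot all_order all_algebra.
From mathcomp Require Import all_classical all_reals all_analysis.

Set Implicit Arguments.
Unset Strict Implicit.
Unset Printing Implicit Defensive.

Import Order.TTheory GRing.Theory Num.Theory.

Local Open Scope classical_set_scope.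
Local Open Scope ring_scope.

(* MathComp-Analysis equips matrices with the entrywise maximum norm, hence
   the explicit Frobenius norm. *)
Definition frobenius (R : realType) (m n : nat) (A : 'M[R]_(m, n)) : R :=
  Num.sqrt (\sum_(i < m) \sum_(j < n) A i j ^+ 2).

Definition pair_norm (R : realType) (m n : nat)
    (z : 'M[R]_(m, n) * 'M[R]_(m, n)) : R :=
  Num.max (frobenius z.1) (frobenius z.2).

(* Entrywise measurability is Borel measurability for the norm topology, since
   the space of matrices is finite-dimensional. *)
Definition random_matrix (R : realType) (d : measure_display)
    (T : measurableType d) (m n : nat) (X : T -> 'M[R]_(m, n)) : Prop :=
  forall (i : 'I_m) (j : 'I_n), measurable_fun [set: T] (fun w => X w i j).

(* The expectation of X exists and equals M. *)
Definition has_expectation (R : realType) (d : measure_display)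
    (T : measurableType d) (P : probability T R) (m n : nat)
    (X : T -> 'M[R]_(m, n)) (M : 'M[R]_(m, n)) : Prop :=
  forall (i : 'I_m) (j : 'I_n),
    P.-integrable [set: T] (fun w => (X w i j)%:E) /\
    ('E_P[fun w => X w i j] = (M i j)%:E)%E.

(* On the product space T * T with P \x P, the variable W \o snd is an
   independent copy of W \o fst, and both have the law of W under P. *)
Definition concentrated (R : realType) (d : measure_display)
    (T : measurableType d) (P : probability T R) (W : T -> R)
    (alpha : R -> R) : Prop :=
  forall t : R, 0 < t ->
    ((P \x P) [set w : T * T | (t <= `|W w.1 - W w.2|)%R]
       <= (alpha t)%:E)%E.

Definition concentrated_around (R : realType) (d : measure_display)
    (T : measurableType d) (P : probability T R) (W : T -> R) (a : R)
    (alpha : R -> R) : Prop :=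
  forall t : R, 0 < t ->
    (P [set w : T | (t <= `|W w - a|)%R] <= (alpha t)%:E)%E.

(* The norm N is an explicit argument of the two notions below, because it is
   not the canonical norm of the library on V. *)
Definition lipschitz_concentrated (R : realType) (d : measure_display)
    (T : measurableType d) (P : probability T R) (V : lmodType R)
    (N : V -> R) (Z : T -> V) (alpha : R -> R) : Prop :=
  forall f : V -> R, (forall x y : V, `|f x - f y| <= N (x - y)) ->
    concentrated P (fun w => f (Z w)) alpha.

Definition linearly_concentrated (R : realType) (d : measure_display)
    (T : measurableType d) (P : probability T R) (V : lmodType R)
    (N : V -> R) (Z : T -> V) (M : V) (alpha : R -> R) : Prop :=
  forall u : {scalar V}, (forall z : V, `|u z| <= N z) ->
    concentrated_around P (fun w => u (Z w)) (u M) alpha.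

(* exp (- (t / s) ^ r) for t > 0 and s >= 0, where t / 0 is read as +oo and
   exp (- oo) as 0 (the division of R would give t / 0 = 0 instead). *)
Definition exp_decay (R : realType) (s r t : R) : R :=
  if s == 0 then 0 else expR (- ((t / s) `^ r)).

(* Main.v *)
(** A linear form [u] of norm at most 1 is [z |-> <B, z>] with [|B| <= 1], so
    [u (X^T A Y) = <A^T X B, Y> = <X, A Y B^T>] is bilinear in [(X, Y)]; on the
    set where [|A^T X B| <= K] and [|A Y B^T| <= K] it is [2 K]-Lipschitz, hence
    coincides there with a Lipschitz function of the whole space (McShane), to
    which the concentration hypothesis applies. The entries of [A^T X B] are
    centered linear forms of [X], so [E |A^T X B| ^+ 2] is at most a constant
    times [(sigma |A| |B|) ^+ 2], and the Lipschitz function [|A^T X B|] exceeds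
    [K = sigma |A| (tau + rho)] with probability at most [2 C exp (- tau ^+ q)],
    where [rho] depends on [C] only. With [t = sigma ^+ 2 |A| tau ^+ 2] both
    errors are of the order of [exp (- (t / (sigma ^+ 2 |A|)) `^ (q / 2))]: the
    second term of the bound suffices, because for [t] of the order of
    [sigma ^+ 2 |A|] or less the bound exceeds 1 as soon as [C'] is large. *)

Require Import Defs.
From HB Require Import structures.
From mathcomp Require Import all_boot all_order all_algebra.
From mathcomp Require Import all_classical all_reals all_analysis.
From mathcomp Require Import measurable_realfun ring lra.

Import Order.TTheory GRing.Theory Num.Theory.

Set Implicit Arguments.
Unset Strict Implicit.
Unset Printing Implicit Defensive.

Local Open Scope classical_set_scope.
Local Open Scope ring_scope.

(** * Frobenius inner product and norm *)

Definition mxdot {R : realType} {m n : nat} (A B : 'M[R]_(m, n)) : R :=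
  \sum_(i < m) \sum_(j < n) A i j * B i j.

Lemma mxdotE (R : realType) (m n : nat) (A B : 'M[R]_(m, n)) :
  mxdot A B = \tr (A^T *m B).
Proof.
rewrite /mxdot exchange_big; apply: eq_bigr => j _; rewrite mxE.
by apply: eq_bigr => i _; rewrite mxE.
Qed.

Lemma mxdotBl (R : realType) (m n : nat) (A B D : 'M[R]_(m, n)) :
  mxdot (A - B) D = mxdot A D - mxdot B D.
Proof. by rewrite !mxdotE [(A - B)^T]raddfB mulmxBl raddfB. Qed.

Lemma mxdotBr (R : realType) (m n : nat) (A B D : 'M[R]_(m, n)) :
  mxdot D (A - B) = mxdot D A - mxdot D B.
Proof. by rewrite !mxdotE mulmxBr raddfB. Qed.

Lemma mxdot0l (R : realType) (m n : nat) (A : 'M[R]_(m, n)) : mxdot 0 A = 0.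
Proof. by rewrite mxdotE trmx0 mul0mx mxtrace0. Qed.

Lemma mxdotC (R : realType) (m n : nat) (A B : 'M[R]_(m, n)) :
  mxdot A B = mxdot B A.
Proof. by apply: eq_bigr => i _; apply: eq_bigr => j _; rewrite mulrC. Qed.

(** Cyclicity of the trace. It lets the bilinear form be read as linear in [x] or linear in [y],
    with the other variable inside the sandwich. *)
Lemma mxdot_mul (R : realType) (m n k l : nat) (A : 'M[R]_(m, k))
    (x : 'M[R]_(m, n)) (B : 'M[R]_(n, l)) (y : 'M[R]_(k, l)) :
  mxdot (A^T *m x *m B) y = mxdot x (A *m y *m B^T).
Proof.
by rewrite !mxdotE !trmx_mul trmxK -!mulmxA mxtrace_mulC !mulmxA.
Qed.

Lemma mxdot_ge0 (R : realType) (m n : nat) (A : 'M[R]_(m, n)) :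
  0 <= mxdot A A.
Proof.
by apply: sumr_ge0 => i _; apply: sumr_ge0 => j _; rewrite -expr2 sqr_ge0.
Qed.

Lemma mxdot_frobenius (R : realType) (m n : nat) (A : 'M[R]_(m, n)) :
  mxdot A A = frobenius A ^+ 2.
Proof.
by rewrite -[LHS]sqr_sqrtr ?mxdot_ge0.
Qed.

Lemma frobenius_ge0 (R : realType) (m n : nat) (A : 'M[R]_(m, n)) :
  0 <= frobenius A.
Proof. exact: sqrtr_ge0. Qed.

Lemma frobenius_eq0 (R : realType) (m n : nat) (A : 'M[R]_(m, n)) :
  frobenius A = 0 -> A = 0.
Proof.
move=> A0; have : mxdot A A = 0 by rewrite mxdot_frobenius A0 expr0n.
have ge0 i j : 0 <= A i j * A i j by rewrite -expr2 sqr_ge0.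
move=> /psumr_eq0P A0'; apply/matrixP => i j; rewrite mxE.
have /psumr_eq0P := A0' (fun i _ => sumr_ge0 _ (fun j _ => ge0 i j)) i isT.
by move=> /(_ (fun j _ => ge0 i j) j isT)/eqP; rewrite mulf_eq0 orbb => /eqP.
Qed.

(** Cauchy-Schwarz; all Lipschitz constants below come from it. *)
Lemma mxdot_le (R : realType) (m n : nat) (A B : 'M[R]_(m, n)) :
  `|mxdot A B| <= frobenius A * frobenius B.
Proof.
wlog suff le : A B / mxdot A B <= frobenius A * frobenius B.
  rewrite ler_norml le// andbT.
  have := le (- A) B; rewrite lerNl.
  have -> : frobenius (- A) = frobenius A.
    by congr Num.sqrt; apply: eq_bigr => i _; apply: eq_bigr => j _;
      rewrite mxE sqrrN.
  by rewrite -[- A]add0r mxdotBl mxdot0l sub0r.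
have [/frobenius_eq0 ->|a0] := eqVneq (frobenius A) 0.
  by rewrite mxdot0l mulr_ge0 ?frobenius_ge0.
have [/frobenius_eq0 ->|b0] := eqVneq (frobenius B) 0.
  by rewrite mxdotC mxdot0l mulr_ge0 ?frobenius_ge0.
have ap : 0 < frobenius A by rewrite lt0r a0 frobenius_ge0.
have bp : 0 < frobenius B by rewrite lt0r b0 frobenius_ge0.
set a := frobenius A in a0 ap *; set b := frobenius B in b0 bp *.
(* This square expands to [2 * a * b * (a * b - mxdot A B)]. *)
have : 0 <= mxdot (b *: A - a *: B) (b *: A - a *: B) by exact: mxdot_ge0.
have Zl c (D E : 'M[R]_(m, n)) : mxdot (c *: D) E = c * mxdot D E.
  by rewrite !mxdotE linearZ -scalemxAl linearZ.
rewrite mxdotBl !mxdotBr !Zl !(mxdotC _ (_ *: _)) !Zl (mxdotC B A).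
rewrite !mxdot_frobenius -/a -/b => h.
have ab : 0 < a * b by rewrite mulr_gt0.
by rewrite -(ler_pM2l ab); nra.
Qed.

Lemma frobenius_subr (R : realType) (m n : nat) (A B : 'M[R]_(m, n)) :
  frobenius (A - B) = frobenius (B - A).
Proof.
congr Num.sqrt; apply: eq_bigr => i _; apply: eq_bigr => j _.
by rewrite !mxE -sqrrN opprB.
Qed.

Lemma frobeniusB_le (R : realType) (m n : nat) (A B D : 'M[R]_(m, n)) :
  frobenius (A - D) <= frobenius (A - B) + frobenius (B - D).
Proof.
rewrite -(@ler_pXn2r _ 2)// ?nnegrE ?addr_ge0 ?frobenius_ge0//.
have -> : A - D = (A - B) - (D - B) by rewrite opprB addrA subrK.
rewrite (frobenius_subr B D).
move: (A - B) (D - B) => {A B D} A D.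
rewrite -mxdot_frobenius mxdotBl !mxdotBr (mxdotC D A) !mxdot_frobenius.
have := mxdot_le A D; rewrite ler_norml => /andP[h _].
by rewrite sqrrD; lra.
Qed.

Lemma frobeniusB_lip (R : realType) (m n : nat) (A B : 'M[R]_(m, n)) :
  `|frobenius A - frobenius B| <= frobenius (A - B).
Proof.
have := frobeniusB_le A B 0; have := frobeniusB_le B A 0.
rewrite !subr0 (frobenius_subr B A) ler_norml => h1 h2.
by apply/andP; split; lra.
Qed.

Lemma frobenius_tr (R : realType) (m n : nat) (A : 'M[R]_(m, n)) :
  frobenius A^T = frobenius A.
Proof.
rewrite /frobenius exchange_big; congr Num.sqrt.
by apply: eq_bigr => i _; apply: eq_bigr => j _; rewrite mxE.
Qed.

(** Each entry of the product is a row of [A] against a column of [B]: Cauchy-Schwarz entry by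
    entry, then summation of the squares. *)
Lemma frobenius_mul (R : realType) (m n k : nat) (A : 'M[R]_(m, n))
    (B : 'M[R]_(n, k)) :
  frobenius (A *m B) <= frobenius A * frobenius B.
Proof.
rewrite -(@ler_pXn2r _ 2)// ?nnegrE ?mulr_ge0 ?frobenius_ge0// exprMn.
rewrite -!mxdot_frobenius /mxdot mulr_suml; apply: ler_sum => i _.
rewrite exchange_big/= mulr_sumr; apply: ler_sum => j _.
have : `|mxdot (row i A)^T (col j B)| ^+ 2 <=
    (frobenius (row i A)^T * frobenius (col j B)) ^+ 2.
  by rewrite ler_pXn2r ?nnegrE ?mulr_ge0 ?frobenius_ge0// mxdot_le.
rewrite -normrX ger0_norm ?sqr_ge0// exprMn -!mxdot_frobenius /mxdot.
rewrite mxE -expr2; congr (_ ^+ 2 <= _ * _); apply: eq_bigr => l _;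
  by rewrite big_ord1 !mxE.
Qed.

(** * Moments from tails *)

(* Sum over [k] of [4 * expR (- k / 2)], which dominates that of
   [(2 * k + 1) * expR (- k ^+ q)]. *)
Definition moment_const (R : realType) : R := 4 / (1 - expR (- 2^-1)).

Lemma moment_const_gt0 (R : realType) : 0 < moment_const R.
Proof.
by rewrite divr_gt0// subr_gt0 expR_lt1 oppr_lt0 invr_gt0.
Qed.

Lemma moment_const_ge0 (R : realType) : 0 <= moment_const R.
Proof. exact: ltW (moment_const_gt0 R). Qed.

Lemma sum_odd_sq (R : realType) (m : nat) :
  \sum_(0 <= k < m) (2 * k%:R + 1) = m%:R ^+ 2 :> R.
Proof.
elim: m => [|m IH]; first by rewrite big_geq// expr0n.
by rewrite big_nat_recr//= IH -natr1; ring.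
Qed.

(** An integer satisfies [k <= k ^+ q], which reduces to exponent 1; then
    [1 + k / 2 <= expR (k / 2)] absorbs the linear factor. The resulting geometric bound is uniform
    in [q]. *)
Lemma odd_expR_le (R : realType) (q k : nat) : (1 <= q)%N ->
  (2 * k%:R + 1) * expR (- (k%:R ^+ q)) <= 4 * expR (- 2^-1) ^+ k :> R.
Proof.
move=> q1.
have kq : k%:R <= k%:R ^+ q :> R.
  case: k => [|k]; first by rewrite -natrX ler_nat.
  by rewrite -natrX ler_nat -[leqLHS]expn1 leq_pexp2l.
have -> : expR (- 2^-1) ^+ k = expR (- (k%:R / 2)) :> R.
  by rewrite -expRM_natl; congr expR; rewrite mulrN.
have h1 : expR (- (k%:R ^+ q)) <= expR (- k%:R) :> R by rewrite ler_expR lerN2.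
have h2 : 1 + k%:R / 2 <= expR (k%:R / 2) :> R by exact: expR_ge1Dx.
have -> : expR (- (k%:R / 2)) = expR (k%:R / 2) * expR (- k%:R) :> R.
  by rewrite -expRD; congr expR; field.
rewrite [in leRHS]mulrA; apply: ler_pM => //; rewrite ?expR_ge0 //.
by have : 0 <= k%:R :> R by []; lra.
Qed.

(** A layer-cake formula discretised at the levels [k * s]; the tail hypothesis then bounds the
    terms by a geometric series. *)
Lemma second_moment_of_tail (R : realType) (d : measure_display)
    (T : measurableType d) (P : probability T R) (V : T -> R) (q : nat)
    (K s : R) :
  (1 <= q)%N -> 1 <= K -> 0 < s -> measurable_fun [set: T] V ->
  (forall w, 0 <= V w) ->
  (forall t, 0 < t ->
     (P [set w | (t <= V w)%R] <= (K * expR (- ((t / s) ^+ q)))%:E)%E) ->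
  (\int[P]_w (V w ^+ 2)%:E <= (K * moment_const R * s ^+ 2)%:E)%E.
Proof.
move=> q1 K1 s0 mV V0 tail.
pose A k := [set w | (k%:R * s <= V w)%R].
have mA k : measurable (A k).
  by have := measurable_fun_le measurableT (measurable_cst (k%:R * s)) mV;
    rewrite setTI.
(* [V ^+ 2 <= s ^+ 2 * \sum_k (2 * k + 1) * 1_(k * s <= V)] *)
pose g k w : \bar R := (((2 * k%:R + 1) * s ^+ 2)%:E * (\1_(A k) w)%:E)%E.
have c0 k : 0 <= (2 * k%:R + 1) * s ^+ 2 :> R.
  by rewrite mulr_ge0 ?sqr_ge0// addr_ge0// mulr_ge0.
have g0 k w : (0 <= g k w)%E by rewrite mule_ge0 ?lee_fin.
have mg k : measurable_fun [set: T] (g k).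
  by apply: emeasurable_funM => //; apply/measurable_EFinP.
have le1 w : ((V w ^+ 2)%:E <= \sum_(0 <= k <oo) g k w)%E.
  (* The indicators of index at most [m] are all 1 at [w], and their coefficients add up to
     [(m + 1) ^+ 2 * s ^+ 2], which exceeds [V w ^+ 2]. *)
  pose m := Num.truncn (V w / s).
  have /andP[mV1 mV2] := truncn_itv (divr_ge0 (V0 w) (ltW s0)).
  apply: (@le_trans _ _ (\sum_(0 <= k < m.+1) g k w)%E); last first.
    by apply: nneseries_lim_ge => // k _.
  have -> : (\sum_(0 <= k < m.+1) g k w)%E = (m.+1%:R ^+ 2 * s ^+ 2)%:E.
    rewrite -sum_odd_sq mulr_suml -sumEFin; apply: eq_big_nat => k /andP[_ km].
    rewrite /g indicE mem_set ?mule1//= /A/=.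
    rewrite -ler_pdivlMr//; apply: le_trans mV1.
    by rewrite ler_nat -ltnS.
  rewrite lee_fin -exprMn ler_pXn2r ?nnegrE ?V0 ?mulr_ge0 ?(ltW s0)//.
  by rewrite -ler_pdivrMr// ltW.
apply: (@le_trans _ _ (\int[P]_w \sum_(0 <= k <oo) g k w)%E).
  apply: ge0_le_integral => //.
  - by move=> w _; rewrite lee_fin sqr_ge0.
  - by apply/measurable_EFinP; exact: measurable_funX.
  - by apply: ge0_emeasurable_sum => // k w _ _.
rewrite integral_nneseries//.
have tailk k : (P (A k) <= (K * expR (- (k%:R ^+ q)))%:E)%E.
  (* The tail is assumed for [t > 0] only; at [k = 0] the bound is [K], at least 1. *)
  case: k => [|k].
    rewrite expr0n eqn0Ngt q1/= oppr0 expR0 mulr1.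
    by apply: le_trans (probability_le1 _ (mA _)) _; rewrite lee_fin.
  by have := @tail (k.+1%:R * s); rewrite mulfK ?gt_eqF//; apply; rewrite mulr_gt0.
have gk k : (\int[P]_w g k w <= (4 * K * s ^+ 2 * expR (- 2^-1) ^+ k)%:E)%E.
  rewrite /g ge0_integralZl_EFin//; last by apply/measurable_EFinP.
  rewrite integral_indic// setIT.
  apply: (@le_trans _ _ (((2 * k%:R + 1) * s ^+ 2)%:E *
    (K * expR (- (k%:R ^+ q)))%:E)%E).
    by apply: lee_wpmul2l; rewrite ?lee_fin ?tailk.
  rewrite -EFinM lee_fin.
  have -> : (2 * k%:R + 1) * s ^+ 2 * (K * expR (- k%:R ^+ q)) =
    (K * s ^+ 2) * ((2 * k%:R + 1) * expR (- k%:R ^+ q)) by ring.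
  have -> : 4 * K * s ^+ 2 * expR (- 2^-1) ^+ k =
    (K * s ^+ 2) * (4 * expR (- 2^-1) ^+ k) by ring.
  by rewrite ler_wpM2l ?odd_expR_le// mulr_ge0 ?sqr_ge0// (le_trans _ K1).
apply: lime_le; first by apply: is_cvg_nneseries => k _ _; exact: integral_ge0.
apply: nearW => m.
apply: (@le_trans _ _
  (\sum_(0 <= k < m) (4 * K * s ^+ 2 * expR (- 2^-1) ^+ k)%:E)%E).
  by apply: lee_sum => k _.
rewrite sumEFin lee_fin.
have := @geometric_le_lim R m (4 * K * s ^+ 2) (expR (- 2^-1)).
rewrite /series/= /geometric/= => /(_ _ (expR_gt0 _) _)/le_trans; apply.
- by rewrite mulr_ge0 ?sqr_ge0// mulr_ge0// (le_trans _ K1).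
- by rewrite ger0_norm ?expR_ge0// expR_lt1 oppr_lt0 invr_gt0.
- by rewrite le_eqVlt; apply/orP; left; apply/eqP; rewrite /moment_const; ring.
Qed.

(** * Independent copies *)

Lemma measurable_le_set (R : realType) (d : measure_display)
    (T : measurableType d) (f g : T -> R) :
  measurable_fun [set: T] f -> measurable_fun [set: T] g ->
  measurable [set w | (f w <= g w)%R].
Proof.
by move=> mf mg; have := measurable_fun_le measurableT mf mg; rewrite setTI.
Qed.

Lemma measurable_fun_norm (R : realType) (d : measure_display)
    (T : measurableType d) (f : T -> R) :
  measurable_fun [set: T] f -> measurable_fun [set: T] (fun w => `|f w|).
Proof. by move=> mf; exact: measurableT_comp. Qed.

Lemma measurable_diff (R : realType) (d : measure_display)
    (T : measurableType d) (W : T -> R) :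
  measurable_fun [set: T] W ->
  measurable_fun [set: T * T] (fun w => W w.1 - W w.2).
Proof.
move=> mW; apply: measurable_funB.
- exact: (measurableT_comp mW measurable_fst).
- exact: (measurableT_comp mW measurable_snd).
Qed.

Lemma integral_cst_probability (R : realType) (d : measure_display)
    (T : measurableType d) (P : probability T R) (c : \bar R) :
  (\int[P]_w c = c)%E.
Proof.
rewrite integral_cst// -[RHS]mule1; congr (_ * _)%E; exact: probability_setT.
Qed.

(** If the integral of [g] is infinite the bound is trivial; otherwise [g], being nonnegative, is
    integrable and monotonicity applies. *)
Lemma le_integral_ge0 (R : realType) (d : measure_display)
    (T : measurableType d) (P : probability T R) (f g : T -> \bar R) :
  P.-integrable [set: T] f -> measurable_fun [set: T] g ->
  (forall w, (0 <= g w)%E) -> (forall w, (f w <= g w)%E) ->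
  (\int[P]_w f w <= \int[P]_w g w)%E.
Proof.
move=> fi mg g0 fg.
have [gy|gy] := ltP (\int[P]_w g w)%E +oo%E; last exact: le_trans (leey _) gy.
apply: le_integral => //.
apply/integrableP; split => //.
by under eq_integral => w _ do rewrite gee0_abs//.
Qed.

(* Integrating [(a - b) ^+ 2 >= a ^+ 2 - 2 * a * b] in [b] only requires [W]
   to be integrable, not square integrable. *)
Lemma second_moment_le_diff (R : realType) (d : measure_display)
    (T : measurableType d) (P : probability T R) (W : T -> R) :
  P.-integrable [set: T] (EFin \o W) -> (\int[P]_w (W w)%:E = 0)%E ->
  (\int[P]_w (W w ^+ 2)%:E <= \int[P \x P]_w ((W w.1 - W w.2) ^+ 2)%:E)%E.
Proof.
move=> Wi W0.
have mW : measurable_fun [set: T] W by apply/measurable_EFinP; case/integrableP: Wi.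
have mD : measurable_fun [set: T * T] (fun w => ((W w.1 - W w.2) ^+ 2)%:E).
  by apply/measurable_EFinP/measurable_funX; exact: measurable_diff.
have D0 (w : T * T) : (0 <= ((W w.1 - W w.2) ^+ 2)%:E)%E by rewrite lee_fin sqr_ge0.
rewrite fubini_tonelli1//.
apply: ge0_le_integral => //.
- by move=> w _; rewrite lee_fin sqr_ge0.
- by apply/measurable_EFinP; exact: measurable_funX.
- exact: measurable_fun_fubini_tonelli_F.
move=> x _; rewrite /fubini_F.
have Wxi : P.-integrable [set: T] (fun y => (2 * W x)%:E * (W y)%:E)%E.
  by apply: integrableZl.
have ci : P.-integrable [set: T] (cst (W x ^+ 2)%:E).
  exact: finite_measure_integrable_cst.
have -> : (W x ^+ 2)%:E = (\int[P]_y ((W x ^+ 2)%:E - (2 * W x)%:E * (W y)%:E))%E.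
  rewrite integralB// integral_cst_probability integralZl//.
  by rewrite W0 mule0 sube0.
apply: le_integral_ge0 => //=.
- exact: (integrableB measurableT ci Wxi).
- apply/measurable_EFinP/measurable_funX; apply: measurable_funB => //.
- by move=> w; rewrite lee_fin sqr_ge0.
- move=> w.
  suff : ((W x ^+ 2 - 2 * W x * W w)%:E <= ((W x - W w) ^+ 2)%:E)%E by [].
  rewrite lee_fin sqrrB.
  by have := sqr_ge0 (W w); lra.
Qed.

(** By Fubini the mean over [x] of the integral of [|W x - W y|] in [y] is at most [D], so it cannot
    exceed [2 * D] for every [x]. A good [x] gives [m = W x], and [W] is integrable as a constant
    minus an integrable function. *)
Lemma integrable_of_diff (R : realType) (d : measure_display)
    (T : measurableType d) (P : probability T R) (W : T -> R) (D : R) :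
  measurable_fun [set: T] W -> 0 < D ->
  (\int[P \x P]_w (`|W w.1 - W w.2|)%:E <= D%:E)%E ->
  exists m, P.-integrable [set: T] (EFin \o W) /\
    (\int[P]_w (`|W w - m|)%:E <= (2 * D)%:E)%E.
Proof.
move=> mW D0.
have mA : measurable_fun [set: T * T] (fun w => (`|W w.1 - W w.2|)%:E).
  by apply/measurable_EFinP/measurable_fun_norm; exact: measurable_diff.
have A0 (w : T * T) : (0 <= (`|W w.1 - W w.2|)%:E)%E by rewrite lee_fin.
rewrite fubini_tonelli1// => FD.
have [x Fx] : exists x, (\int[P]_y (`|W x - W y|)%:E <= (2 * D)%:E)%E.
  apply: contrapT => /forallNP F2D.
  have : (\int[P]_x cst (2 * D)%:E x <= D%:E)%E.
    apply: le_trans FD; apply: ge0_le_integral => //.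
    - by move=> w _; rewrite lee_fin mulr_ge0// ltW.
    - exact: measurable_fun_fubini_tonelli_F.
    - by move=> w _; have /negP := F2D w; rewrite -ltNge => /ltW.
  by rewrite integral_cst_probability lee_fin; lra.
exists (W x); split; last by under eq_integral => y _ do rewrite distrC.
have ci : P.-integrable [set: T] (cst (W x)%:E).
  exact: finite_measure_integrable_cst.
have di : P.-integrable [set: T] (fun y => (W x - W y)%:E).
  apply/integrableP; split => //=.
    by apply/measurable_EFinP; exact: measurable_funB.
  by apply: le_lt_trans Fx _; rewrite ltry.
have := integrableB measurableT ci di.
apply: eq_integrable => // y _ /=.
by rewrite -EFinB opprB addrC subrK.
Qed.

Lemma markov_half (R : realType) (d : measure_display)
    (T : measurableType d) (P : probability T R) (W : T -> R) (r : R) :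
  measurable_fun [set: T] W -> 0 < r ->
  (\int[P]_w (`|W w|)%:E <= (r / 2)%:E)%E ->
  (P [set w | (r <= `|W w|)%R] <= (2^-1)%:E)%E.
Proof.
move=> mW r0 h.
have := @le_integral_abse _ _ _ P setT measurableT (EFin \o W) r.
move=> /(_ _ r0); rewrite setTI/=.
have -> : [set x | (r%:E <= (`|W x|%R)%:E)%E] = [set w | (r <= `|W w|)%R].
  by apply/seteqP; split => w /=; rewrite lee_fin.
move=> /(_ ((measurable_EFinP _ _).2 mW)) /le_trans => /(_ _ h).
by rewrite -lee_pdivlMl// -EFinM mulKf ?gt_eqF.
Qed.

(** If [W x] is at distance at least [t + r] from [m] and [W y] at distance less than [r], the two
    differ by at least [t]. The second event has probability at least 1/2, and independence turns
    this into the factor 2. *)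
Lemma recenter (R : realType) (d : measure_display)
    (T : measurableType d) (P : probability T R) (W : T -> R) (m r t a : R) :
  measurable_fun [set: T] W ->
  (P [set w | (r <= `|W w - m|)%R] <= (2^-1)%:E)%E ->
  ((P \x P) [set w | (t <= `|W w.1 - W w.2|)%R] <= a%:E)%E ->
  (P [set w | (t + r <= `|W w - m|)%R] <= (2 * a)%:E)%E.
Proof.
move=> mW Ph Pa.
have mN : measurable_fun [set: T] (fun w => `|W w - m|).
  by apply: measurable_fun_norm; exact: measurable_funB.
set A := [set w | (t + r <= `|W w - m|)%R].
set B := [set w | (r <= `|W w - m|)%R] in Ph *.
have mA : measurable A by exact: measurable_le_set.
have mB : measurable B by exact: measurable_le_set.
have AB : (P A * P (~` B) <= a%:E)%E.
  rewrite -product_measure1E//; last exact: measurableC.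
  apply: le_trans Pa; apply: le_measure; rewrite ?inE.
  - by apply: measurableX => //; exact: measurableC.
  - apply: measurable_le_set => //.
    by apply: measurable_fun_norm; exact: measurable_diff.
  move=> [x y]/= [Ax /negP]; rewrite -ltNge => By.
  rewrite /A/= in Ax.
  have := ler_distD (W y) (W x) m.
  by lra.
have PB : ((2^-1)%:E <= P (~` B))%E.
  rewrite probability_setC// leeBrDr ?fin_num_measure//.
  by apply: le_trans (leeD2l _ Ph) _; rewrite -EFinD lee_fin; lra.
have : (P A * (2^-1)%:E <= a%:E)%E.
  by apply: le_trans AB; rewrite lee_wpmul2l.
rewrite -(@fineK _ (P A)) ?fin_num_measure// -EFinM !lee_fin; lra.
Qed.

(** * Lipschitz functions of random matrices *)

Lemma pair_norm0 (R : realType) (m n : nat) : @pair_norm R m n 0 = 0.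
Proof.
have f0 : frobenius (0 : 'M[R]_(m, n)) = 0.
  by apply/eqP; rewrite -sqrf_eq0 -mxdot_frobenius mxdot0l.
by rewrite /pair_norm /= f0 maxxx.
Qed.

Lemma pair_norm_subr (R : realType) (m n : nat)
    (x y : 'M[R]_(m, n) * 'M[R]_(m, n)) : pair_norm (x - y) = pair_norm (y - x).
Proof.
by rewrite /pair_norm /= frobenius_subr [frobenius (x.2 - _)]frobenius_subr.
Qed.

Lemma pair_normB_le (R : realType) (m n : nat)
    (x y z : 'M[R]_(m, n) * 'M[R]_(m, n)) :
  pair_norm (x - z) <= pair_norm (x - y) + pair_norm (y - z).
Proof.
rewrite {1}/pair_norm /= ge_max; apply/andP; split.
- apply: le_trans (frobeniusB_le _ y.1 _) _.
  by apply: lerD; rewrite le_max lexx.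
- apply: le_trans (frobeniusB_le _ y.2 _) _.
  by apply: lerD; rewrite le_max lexx orbT.
Qed.

(** McShane's formula: [g x] is the infimum over [s] in [S] of [phi s + L * N (x - s)]. A fixed
    point [s0] of [S] bounds this family from below. *)
Lemma lipschitz_extension (R : realType) (V : zmodType) (N : V -> R)
    (S : set V) (phi : V -> R) (L : R) :
  N 0 = 0 -> (forall x y, N (x - y) = N (y - x)) ->
  (forall x y z, N (x - z) <= N (x - y) + N (y - z)) ->
  0 <= L -> S !=set0 ->
  (forall x y, S x -> S y -> phi x - phi y <= L * N (x - y)) ->
  exists g : V -> R, (forall x, S x -> g x = phi x) /\
    forall x y, `|g x - g y| <= L * N (x - y).
Proof.
move=> N0 NC Ntri L0 [s0 Ss0] lip.
pose E x := [set phi s + L * N (x - s) | s in S].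
have En x : E x !=set0 by exists (phi s0 + L * N (x - s0)), s0.
have Elb x : lbound (E x) (phi s0 - L * N (s0 - x)).
  move=> _ [s Ss <-]; have := lip _ _ Ss0 Ss.
  by have := ler_wpM2l L0 (Ntri s0 x s); rewrite mulrDr; lra.
have Einf x : has_inf (E x) by split=> //; exists (phi s0 - L * N (s0 - x)).
have gle x s : S s -> inf (E x) <= phi s + L * N (x - s).
  by move=> Ss; apply: ge_inf; [exact: (Einf x).2|exists s].
have lip1 x y : inf (E x) <= inf (E y) + L * N (x - y).
  rewrite -lerBlDr; apply: lb_le_inf => // _ [s Ss <-].
  rewrite lerBlDr; apply: le_trans (gle x s Ss) _.
  by have := ler_wpM2l L0 (Ntri x y s); rewrite mulrDr; lra.
exists (fun x => inf (E x)); split.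
  move=> x Sx; apply/eqP; rewrite eq_le; apply/andP; split.
    by apply: le_trans (gle x x Sx) _; rewrite subrr N0 mulr0 addr0.
  apply: lb_le_inf => // _ [s Ss <-].
  by have := lip _ _ Sx Ss; lra.
move=> x y; rewrite ler_norml.
by have := lip1 x y; have := lip1 y x; rewrite (NC y x) => h1 h2; apply/andP; lra.
Qed.

(** * Density of rational matrices and measurability *)

Lemma rat_matrix_dense (R : realType) (m n : nat) (A : 'M[R]_(m, n)) (e : R) :
  0 < e -> exists B : 'M[rat]_(m, n), frobenius (A - map_mx ratr B) < e.
Proof.
(* Entries within [del = e / k] give a squared norm at most [(k - 1) * del ^+ 2], less than
   [(k * del) ^+ 2]; the added 1 keeps [k] positive for empty matrices. *)
move=> e0; pose k : R := (m * n)%:R + 1.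
have k0 : 0 < k by rewrite ltr_wpDl.
have [del del0 eE] : exists2 del, 0 < del & e = del * k.
  by exists (e / k); rewrite ?divr_gt0// divfK// gt_eqF.
have ex i j : exists r : rat, ratr r \in `]A i j - del, A i j + del[.
  by apply: rat_in_itvoo; lra.
exists (\matrix_(i, j) sval (cid (ex i j))).
rewrite -(@ltr_pXn2r _ 2)// ?nnegrE ?frobenius_ge0 ?(ltW e0)//.
rewrite -mxdot_frobenius.
apply: (@le_lt_trans _ _ (\sum_(i < m) \sum_(j < n) del ^+ 2)).
  apply: ler_sum => i _; apply: ler_sum => j _; rewrite !mxE -expr2.
  case: cid => r /=; rewrite in_itv/= => /andP[h1 h2].
  by rewrite -[_ ^+ 2]ger0_norm ?sqr_ge0// normrX ler_pXn2r ?nnegrE ?(ltW del0)// ler_norml; apply/andP; lra.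
rewrite !sumr_const !card_ord -mulrnA mulnC -mulr_natl.
have -> : (m * n)%:R = k - 1 by rewrite /k addrK.
rewrite eE exprMn [ltLHS]mulrC ltr_pM2l ?exprn_gt0//.
have : 0 < (k - 1) ^+ 2 + k by rewrite ltr_wpDl ?sqr_ge0.
by nra.
Qed.

Lemma measurable_frobenius (R : realType) (d : measure_display)
    (T : measurableType d) (m n : nat) (X : T -> 'M[R]_(m, n)) :
  random_matrix X -> measurable_fun [set: T] (fun w => frobenius (X w)).
Proof.
move=> mX; apply: measurableT_comp.
  by apply: continuous_measurable_fun; exact: sqrt_continuous.
apply: measurable_sum => i; apply: measurable_sum => j.
exact: measurable_funX.
Qed.

Lemma random_matrixB (R : realType) (d : measure_display)
    (T : measurableType d) (m n : nat) (X : T -> 'M[R]_(m, n))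
    (A : 'M[R]_(m, n)) :
  random_matrix X -> random_matrix (fun w => X w - A).
Proof.
move=> mX i j; under eq_fun do rewrite !mxE.
exact: measurable_funB.
Qed.

Lemma random_matrix_mul (R : realType) (d : measure_display)
    (T : measurableType d) (m n k : nat) (X : T -> 'M[R]_(m, n))
    (Y : T -> 'M[R]_(n, k)) :
  random_matrix X -> random_matrix Y -> random_matrix (fun w => X w *m Y w).
Proof.
move=> mX mY i j; under eq_fun do rewrite !mxE.
by apply: measurable_sum => l; exact: measurable_funM.
Qed.

Lemma random_matrix_cst (R : realType) (d : measure_display)
    (T : measurableType d) (m n : nat) (A : 'M[R]_(m, n)) :
  random_matrix (fun _ : T => A).
Proof. by move=> i j. Qed.

Lemma random_matrix_tr (R : realType) (d : measure_display)
    (T : measurableType d) (m n : nat) (X : T -> 'M[R]_(m, n)) :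
  random_matrix X -> random_matrix (fun w => (X w)^T).
Proof. by move=> mX i j; under eq_fun do rewrite mxE; exact: mX. Qed.

Lemma measurable_mxdot (R : realType) (d : measure_display)
    (T : measurableType d) (m n : nat) (X Y : T -> 'M[R]_(m, n)) :
  random_matrix X -> random_matrix Y ->
  measurable_fun [set: T] (fun w => mxdot (X w) (Y w)).
Proof.
move=> mX mY; apply: measurable_sum => i; apply: measurable_sum => j.
exact: measurable_funM.
Qed.

(* A Lipschitz function is the infimum over the rational pairs [q] of
   [f q + pair_norm (z - q)], hence Borel. *)
Lemma measurable_lipschitz (R : realType) (d : measure_display)
    (T : measurableType d) (m n : nat) (X Y : T -> 'M[R]_(m, n))
    (f : 'M[R]_(m, n) * 'M[R]_(m, n) -> R) :
  random_matrix X -> random_matrix Y ->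
  (forall x y, `|f x - f y| <= pair_norm (x - y)) ->
  measurable_fun [set: T] (fun w => f (X w, Y w)).
Proof.
move=> mX mY lip; pose rm (q : 'M[rat]_(m, n) * 'M[rat]_(m, n)) :
  'M[R]_(m, n) * 'M[R]_(m, n) := (map_mx ratr q.1, map_mx ratr q.2).
apply: (measurability _ (RGenInftyO.measurableE R)) => //.
move=> _ [_ [t ->] <-]; rewrite setTI.
have -> : (fun w => f (X w, Y w)) @^-1` `]-oo, t[ =
    \bigcup_q [set w | f (rm q) + pair_norm ((X w, Y w) - rm q) < t].
  apply/seteqP; split => w /=; rewrite in_itv/=.
    (* Half of the gap pays for the change of [f] between the pair and its rational neighbour, the
       other half for the added norm. *)
    move=> ft; have e0 : 0 < (t - f (X w, Y w)) / 2 by lra.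
    have [q1 h1] := rat_matrix_dense (X w) e0.
    have [q2 h2] := rat_matrix_dense (Y w) e0.
    exists (q1, q2) => //=.
    have : pair_norm ((X w, Y w) - rm (q1, q2)) < (t - f (X w, Y w)) / 2.
      by rewrite /pair_norm gt_max h1 h2.
    by have := lip (X w, Y w) (rm (q1, q2)); rewrite ler_norml => /andP[]; lra.
  move=> [q _] /=.
  by have := lip (X w, Y w) (rm q); rewrite ler_norml => /andP[]; lra.
apply: countable_bigcupT_measurable => [|q]; first exact: countableP.
have -> : [set w | f (rm q) + pair_norm ((X w, Y w) - rm q) < t] =
    ~` [set w | (t <= f (rm q) + pair_norm ((X w, Y w) - rm q))%R].
  by apply/seteqP; split => w /=; rewrite ltNge => /negP.
apply: measurableC; apply: measurable_le_set => //; apply: measurable_funD => //.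
apply: (@measurable_maxr _ _ _ _ (fun w => frobenius (X w - (rm q).1))
  (fun w => frobenius (Y w - (rm q).2)));
  by apply: measurable_frobenius; exact: random_matrixB.
Qed.

Lemma mxdot_expectation (R : realType) (d : measure_display)
    (T : measurableType d) (P : probability T R) (m n : nat)
    (Z : T -> 'M[R]_(m, n)) (M G : 'M[R]_(m, n)) :
  has_expectation P Z M ->
  P.-integrable [set: T] (EFin \o (fun w => mxdot G (Z w))) /\
  (\int[P]_w (mxdot G (Z w))%:E = (mxdot G M)%:E)%E.
Proof.
move=> ZM.
have zi i j : P.-integrable [set: T] (fun w => (G i j)%:E * (Z w i j)%:E)%E.
  by apply: integrableZl => //; have [] := ZM i j.
have E w : (mxdot G (Z w))%:E =
    (\sum_(i < m) \sum_(j < n) ((G i j)%:E * (Z w i j)%:E))%E.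
  by rewrite -sumEFin; apply: eq_bigr => i _; rewrite -sumEFin.
split.
  apply: (@eq_integrable _ _ _ _ _ measurableT
      (fun w => \sum_(i < m) \sum_(j < n) ((G i j)%:E * (Z w i j)%:E))%E).
    by move=> w _; rewrite /= E.
  by apply: integrable_sum => // i _; apply: integrable_sum.
under eq_integral => w _ do rewrite E.
rewrite integral_sum//; last by move=> i; apply: integrable_sum.
rewrite -sumEFin; apply: eq_bigr => i _.
rewrite integral_sum//.
rewrite -sumEFin; apply: eq_bigr => j _.
have [Zi ZE] := ZM i j.
by rewrite integralZl// EFinM -ZE unlock.
Qed.

(** * Sandwiched matrices *)

(** The hypothesis applied to the 1-Lipschitz function [f / L] at level [t / L]. The real power
    becomes an integer power here. *)
Lemma lipschitz_concentrated_scale (R : realType) (d : measure_display)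
    (T : measurableType d) (P : probability T R) (V : lmodType R)
    (N : V -> R) (Z : T -> V) (C sigma L t : R) (q : nat) (f : V -> R) :
  0 < sigma -> 0 < L -> 0 < t ->
  lipschitz_concentrated P N Z (fun t => C * exp_decay sigma q%:R t) ->
  (forall x y, `|f x - f y| <= L * N (x - y)) ->
  ((P \x P) [set w : T * T | (t <= `|f (Z w.1) - f (Z w.2)|)%R] <=
    (C * expR (- ((t / (sigma * L)) ^+ q)))%:E)%E.
Proof.
move=> s0 L0 t0 conc lip.
have E x y : `|f x / L - f y / L| = `|f x - f y| / L.
  by rewrite -mulrBl normrM normfV (gtr0_norm L0).
have := conc (fun z => f z / L) _ (t / L) (divr_gt0 t0 L0).
rewrite /exp_decay gt_eqF// powR_mulrn; last first.
  by rewrite !divr_ge0 ?(ltW s0) ?(ltW L0) ?(ltW t0).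
have -> : t / L / sigma = t / (sigma * L).
  by rewrite invfM mulrA mulrAC.
have -> : [set w : T * T | t / L <= `|f (Z w.1) / L - f (Z w.2) / L|] =
    [set w : T * T | (t <= `|f (Z w.1) - f (Z w.2)|)%R].
  by apply/seteqP; split => w /=; rewrite E ler_pM2r ?invr_gt0.
by apply=> x y; rewrite E ler_pdivrMr// mulrC.
Qed.

(** The form [mxdot G] is [frobenius G]-Lipschitz, so its difference with an independent copy has a
    controlled second moment; since it is centered, this dominates its own. *)
Lemma mxdot_second_moment (R : realType) (d : measure_display)
    (T : measurableType d) (P : probability T R) (m n : nat)
    (Z : T -> 'M[R]_(m, n)) (C sigma : R) (q : nat) (G : 'M[R]_(m, n)) :
  (1 <= q)%N -> 1 <= C -> 0 < sigma -> random_matrix Z ->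
  lipschitz_concentrated P (@frobenius R m n) Z
    (fun t => C * exp_decay sigma q%:R t) ->
  has_expectation P Z 0 ->
  (\int[P]_w (mxdot G (Z w) ^+ 2)%:E <=
     (C * moment_const R * (sigma * frobenius G) ^+ 2)%:E)%E.
Proof.
move=> q1 C1 s0 mZ conc Z0.
have [/frobenius_eq0 ->|G0] := eqVneq (frobenius G) 0.
  under eq_integral => w _ do rewrite mxdot0l expr0n/=.
  rewrite integral0 lee_fin mulr_ge0 ?sqr_ge0// mulr_ge0 ?moment_const_ge0//.
  by rewrite (le_trans _ C1).
have {G0} : 0 < frobenius G by rewrite lt0r G0 frobenius_ge0.
move=> G0; have [iG EG] := mxdot_expectation G Z0.
rewrite mxdotC mxdot0l in EG.
have mG : measurable_fun [set: T] (fun w => mxdot G (Z w)).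
  by apply: measurable_mxdot => //; exact: random_matrix_cst.
apply: le_trans (second_moment_le_diff iG EG) _.
under eq_integral => w _ do rewrite -[_ ^+ 2]ger0_norm ?sqr_ge0// normrX.
apply: (second_moment_of_tail q1 C1) => //; first exact: mulr_gt0.
  by apply: measurable_fun_norm; exact: (measurable_diff mG).
move=> t t0; apply: (lipschitz_concentrated_scale s0 G0 t0 conc) => x y.
by rewrite -mxdotBr mxdot_le.
Qed.

(** The entries are centered linear forms given by rank-one matrices [G i j], whose squared norms
    add up to [(frobenius A * frobenius B) ^+ 2]. Hence no dimension enters the bound. *)
Lemma frobenius_second_moment (R : realType) (d : measure_display)
    (T : measurableType d) (P : probability T R) (m n k l : nat)
    (Z : T -> 'M[R]_(m, n)) (C sigma : R) (q : nat)
    (A : 'M[R]_(m, k)) (B : 'M[R]_(n, l)) :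
  (1 <= q)%N -> 1 <= C -> 0 < sigma -> random_matrix Z ->
  lipschitz_concentrated P (@frobenius R m n) Z
    (fun t => C * exp_decay sigma q%:R t) ->
  has_expectation P Z 0 ->
  (\int[P]_w (frobenius (A^T *m Z w *m B) ^+ 2)%:E <=
     (C * moment_const R * (sigma * (frobenius A * frobenius B)) ^+ 2)%:E)%E.
Proof.
move=> q1 C1 s0 mZ conc Z0.
pose G i j := col i A *m (col j B)^T.
have GE i j z : (A^T *m z *m B) i j = mxdot (G i j) z.
  rewrite /mxdot mxE exchange_big /=; apply: eq_bigr => b _.
  rewrite mxE mulr_suml; apply: eq_bigr => a _.
  by rewrite /G !mxE big_ord1 !mxE; ring.
have E w : (frobenius (A^T *m Z w *m B) ^+ 2)%:E =
    (\sum_(i < k) \sum_(j < l) (mxdot (G i j) (Z w) ^+ 2)%:E)%E.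
  rewrite -mxdot_frobenius -sumEFin; apply: eq_bigr => i _.
  by rewrite -sumEFin; apply: eq_bigr => j _; rewrite GE expr2.
under eq_integral => w _ do rewrite E.
have mG i j : measurable_fun [set: T] (fun w => (mxdot (G i j) (Z w) ^+ 2)%:E).
  apply/measurable_EFinP/measurable_funX.
  by apply: measurable_mxdot => //; exact: random_matrix_cst.
have G0 i j w : (0 <= (mxdot (G i j) (Z w) ^+ 2)%:E)%E by rewrite lee_fin sqr_ge0.
rewrite ge0_integral_sum//; last 2 first.
- by move=> i; apply: emeasurable_sum.
- by move=> i w _; apply: sume_ge0.
have -> : C * moment_const R * (sigma * (frobenius A * frobenius B)) ^+ 2 =
  \sum_(i < k) \sum_(j < l) C * moment_const R * (sigma * frobenius (G i j)) ^+ 2.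
  have -> : (sigma * (frobenius A * frobenius B)) ^+ 2 =
    sigma ^+ 2 * (frobenius A ^+ 2 * frobenius B ^+ 2) by ring.
  rewrite -frobenius_tr -mxdot_frobenius -[frobenius B]frobenius_tr.
  rewrite -mxdot_frobenius [mxdot A^T _]/mxdot [mxdot B^T _]/mxdot.
  rewrite big_distrlr !mulr_sumr; apply: eq_bigr => i _ /=.
  rewrite !mulr_sumr; apply: eq_bigr => j _.
  rewrite [in RHS]exprMn -mxdot_frobenius /mxdot big_distrlr /=.
  congr (_ * (_ * _)); apply: eq_bigr => a _; apply: eq_bigr => b _.
  by rewrite /G !mxE big_ord1 !mxE; ring.
rewrite -sumEFin; apply: lee_sum => i _.
rewrite ge0_integral_sum// -sumEFin; apply: lee_sum => j _.
exact: (mxdot_second_moment (G i j) q1 C1 s0 mZ conc Z0).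
Qed.

(** Markov on the second moment puts half of the mass below [sigma * a * rho], and [recenter] around
    0 adds the Lipschitz deviation [sigma * a * tau]. The upper bound [a] stays positive even when
    [B] is 0. *)
Lemma frobenius_tail (R : realType) (d : measure_display)
    (T : measurableType d) (P : probability T R) (m n k l : nat)
    (Z : T -> 'M[R]_(m, n)) (C sigma a : R) (q : nat)
    (A : 'M[R]_(m, k)) (B : 'M[R]_(n, l)) (tau : R) :
  (1 <= q)%N -> 1 <= C -> 0 < sigma -> random_matrix Z ->
  lipschitz_concentrated P (@frobenius R m n) Z
    (fun t => C * exp_decay sigma q%:R t) ->
  has_expectation P Z 0 ->
  0 < a -> frobenius A * frobenius B <= a -> 0 < tau ->
  (P [set w | (sigma * a * (tau + Num.sqrt (2 * C * moment_const R)) <=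
               frobenius (A^T *m Z w *m B))%R] <=
     (2 * (C * expR (- (tau ^+ q))))%:E)%E.
Proof.
move=> q1 C1 s0 mZ conc Z0 a0 ABa tau0.
set rho := Num.sqrt _; set f := fun z => frobenius (A^T *m z *m B).
have C0 : 0 < C by apply: lt_le_trans C1.
have rho2 : rho ^+ 2 = 2 * C * moment_const R.
  by rewrite sqr_sqrtr// mulr_ge0 ?moment_const_ge0// mulr_ge0 ?(ltW C0).
have rho0 : 0 < rho by rewrite sqrtr_gt0 !mulr_gt0// moment_const_gt0.
have sa0 : 0 < sigma * a by rewrite mulr_gt0.
have mf : measurable_fun [set: T] (fun w => f (Z w)).
  apply: measurable_frobenius; apply: random_matrix_mul; last first.
    exact: random_matrix_cst.
  by apply: random_matrix_mul => //; exact: random_matrix_cst.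
have f0 z : 0 <= f z by exact: frobenius_ge0.
have lip x y : `|f x - f y| <= a * frobenius (x - y).
  apply: le_trans (frobeniusB_lip _ _) _.
  rewrite -mulmxBl -mulmxBr; apply: le_trans (frobenius_mul _ _) _.
  apply: (@le_trans _ _ (frobenius A^T * frobenius (x - y) * frobenius B)).
    by rewrite ler_wpM2r ?frobenius_ge0// frobenius_mul.
  by rewrite frobenius_tr mulrAC ler_wpM2r ?frobenius_ge0.
have half : (P [set w | (sigma * a * rho <= `|f (Z w) - 0|)%R] <= (2^-1)%:E)%E.
  (* The factor 2 in [rho ^+ 2] makes the second moment at most half of this threshold. *)
  have := @markov_half _ _ _ P (fun w => f (Z w) ^+ 2) ((sigma * a * rho) ^+ 2).
  rewrite exprn_gt0 ?mulr_gt0//.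
  have -> : [set w | (sigma * a * rho) ^+ 2 <= `|f (Z w) ^+ 2|] =
      [set w | sigma * a * rho <= `|f (Z w) - 0|].
    apply/seteqP; split => w /=; rewrite subr0 normrX ler_pXn2r ?nnegrE//;
      by rewrite mulr_ge0// ltW.
  apply => //; first exact: measurable_funX.
  under eq_integral => w _ do rewrite ger0_norm ?sqr_ge0//.
  apply: le_trans (frobenius_second_moment A B q1 C1 s0 mZ conc Z0) _.
  rewrite lee_fin [(_ * rho) ^+ 2]exprMn rho2.
  have -> : (sigma * a) ^+ 2 * (2 * C * moment_const R) / 2 =
    C * moment_const R * (sigma * a) ^+ 2 by field.
  rewrite ler_wpM2l// ?mulr_ge0 ?moment_const_ge0 ?(ltW C0)//.
  rewrite ler_pXn2r ?nnegrE ?mulr_ge0 ?frobenius_ge0 ?(ltW s0) ?(ltW a0)//.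
  by rewrite ler_pM2l.
have tail := lipschitz_concentrated_scale s0 a0 (mulr_gt0 sa0 tau0) conc lip.
have := recenter mf half tail.
have -> : sigma * a * tau / (sigma * a) = tau by rewrite mulrC mulKf ?gt_eqF.
rewrite -mulrDr.
by under eq_set do rewrite subr0 ger0_norm//.
Qed.

(** * Bilinear forms *)

Lemma expR_pow_le (R : realType) (q : nat) (x y : R) :
  0 <= x -> x <= y -> expR (- (y ^+ q)) <= expR (- (x ^+ q)).
Proof.
by move=> x0 xy; rewrite ler_expR lerN2 lerXn2r ?nnegrE// (le_trans x0).
Qed.

(** The first variable is changed at fixed [z.2], then the second at fixed [z'.1]; each move costs
    [K] times the distance, which is why one bound is asked at each point. *)
Lemma bilinear_lipschitz (R : realType) (p n : nat) (A : 'M[R]_p)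
    (B : 'M[R]_n) (K : R) (z z' : 'M[R]_(p, n) * 'M[R]_(p, n)) :
  frobenius (A *m z.2 *m B^T) <= K -> frobenius (A^T *m z'.1 *m B) <= K ->
  mxdot (A^T *m z.1 *m B) z.2 - mxdot (A^T *m z'.1 *m B) z'.2 <=
    2 * K * pair_norm (z - z').
Proof.
move: z z' => [x y] [x' y'] /= hy hx'.
have -> : mxdot (A^T *m x *m B) y - mxdot (A^T *m x' *m B) y' =
    mxdot (x - x') (A *m y *m B^T) + mxdot (A^T *m x' *m B) (y - y').
  by rewrite mxdotBl mxdotBr -!mxdot_mul; ring.
have N1 : frobenius (x - x') <= pair_norm ((x, y) - (x', y')).
  by rewrite /pair_norm le_max lexx.
have N2 : frobenius (y - y') <= pair_norm ((x, y) - (x', y')).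
  by rewrite /pair_norm le_max lexx orbT.
have h1 := ler_pM (frobenius_ge0 _) (frobenius_ge0 _) N1 hy.
have h2 := ler_pM (frobenius_ge0 _) (frobenius_ge0 _) hx' N2.
have := le_trans (ler_norm _) (mxdot_le (x - x') (A *m y *m B^T)).
have := le_trans (ler_norm _) (mxdot_le (A^T *m x' *m B) (y - y')).
by lra.
Qed.

(** Outside [bad] in both coordinates the differences of [W] and [W'] agree; each coordinate
    contributes one [a]. *)
Lemma concentrated_of_truncation (R : realType) (d : measure_display)
    (T : measurableType d) (P : probability T R) (W W' : T -> R)
    (bad : set T) (a b t : R) :
  measurable_fun [set: T] W -> measurable_fun [set: T] W' -> measurable bad ->
  (forall w, ~ bad w -> W w = W' w) ->
  (P bad <= a%:E)%E ->
  ((P \x P) [set w : T * T | (t <= `|W' w.1 - W' w.2|)%R] <= b%:E)%E ->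
  ((P \x P) [set w : T * T | (t <= `|W w.1 - W w.2|)%R] <= (2 * a + b)%:E)%E.
Proof.
move=> mW mW' mbad WW' Pa Pb.
have mE (V : T -> R) : measurable_fun [set: T] V ->
    measurable [set w : T * T | (t <= `|V w.1 - V w.2|)%R].
  move=> mV; apply: measurable_le_set => //.
  by apply: measurable_fun_norm; exact: (measurable_diff mV).
have PT : P [set: T] = 1%E := @probability_setT _ _ _ P.
have P1 : ((P \x P) (bad `*` setT) <= a%:E)%E.
  by rewrite product_measure1E//= PT mule1.
have P2 : ((P \x P) (setT `*` bad) <= a%:E)%E.
  by rewrite product_measure1E//= PT mul1e.
have m1 : measurable (bad `*` [set: T]) by exact: measurableX.
have m2 : measurable ([set: T] `*` bad) by exact: measurableX.
pose E' := [set w : T * T | (t <= `|W' w.1 - W' w.2|)%R].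
have m12 : measurable ((bad `*` [set: T]) `|` ([set: T] `*` bad)).
  exact: measurableU.
apply: (@le_trans _ _ ((P \x P) ((bad `*` [set: T]) `|` ([set: T] `*` bad) `|` E'))%E).
  apply: le_measure; rewrite ?inE.
  - exact: mE.
  - by apply: measurableU => //; exact: mE.
  move=> [x y] /= h; have [bx|bx] := pselect (bad x); first by left; left.
  have [by'|by'] := pselect (bad y); first by left; right.
  by right; rewrite /E'/= -!WW'.
apply: le_trans (measureU2 _ m12 (mE _ mW')) _.
apply: le_trans (leeD (measureU2 _ m1 m2) Pb) _.
apply: le_trans (leeD2r _ (leeD P1 P2)) _.
by rewrite -!EFinD lee_fin; lra.
Qed.

(** In [9 * C], [8 * C] pays for the bad events of [X] and [Y] in both copies and [C] for the
    Lipschitz extension. The exponential lifts the bound above 1 for small [tau]. *)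
Definition bilinear_const (R : realType) (q : nat) (C : R) : R :=
  9 * C + expR ((Num.sqrt (2 * C * moment_const R) / 4) ^+ q).

Lemma bilinear_concentrated (R : realType) (d : measure_display)
    (T : measurableType d) (P : probability T R) (p n : nat)
    (X Y : T -> 'M[R]_(p, n)) (A : 'M[R]_p) (B : 'M[R]_n) (C sigma a : R)
    (q : nat) (tau : R) :
  (1 <= q)%N -> 1 <= C -> 0 < sigma -> random_matrix X -> random_matrix Y ->
  lipschitz_concentrated P (@pair_norm R p n) (fun w => (X w, Y w))
    (fun t => C * exp_decay sigma q%:R t) ->
  has_expectation P X 0 -> has_expectation P Y 0 ->
  0 < a -> frobenius A * frobenius B <= a -> 0 < tau ->
  ((P \x P) [set w : T * T | (sigma ^+ 2 * a * tau ^+ 2 <=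
     `|mxdot (A^T *m X w.1 *m B) (Y w.1) - mxdot (A^T *m X w.2 *m B) (Y w.2)|)%R]
   <= (bilinear_const q C * expR (- ((tau / 4) ^+ q)))%:E)%E.
Proof.
move=> q1 C1 s0 mX mY conc X0 Y0 a0 ABa tau0.
have C0 : 0 < C by apply: lt_le_trans C1.
rewrite /bilinear_const; set rho := Num.sqrt _.
have rho0 : 0 <= rho by exact: sqrtr_ge0.
have mAXB : random_matrix (fun w => A^T *m X w *m B).
  apply: random_matrix_mul; last exact: random_matrix_cst.
  by apply: random_matrix_mul => //; exact: random_matrix_cst.
have mAYB : random_matrix (fun w => A *m Y w *m B^T).
  apply: random_matrix_mul; last exact: random_matrix_cst.
  by apply: random_matrix_mul => //; exact: random_matrix_cst.
pose phi (z : 'M[R]_(p, n) * 'M[R]_(p, n)) := mxdot (A^T *m z.1 *m B) z.2.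
have mphi : measurable_fun [set: T] (fun w => phi (X w, Y w)).
  exact: measurable_mxdot.
(* For [tau < rho] the bound is at least 1. *)
have [tr|rt] := ltP tau rho.
  apply: (@le_trans _ _ 1%E).
    apply: probability_le1; apply: measurable_le_set => //.
    by apply: measurable_fun_norm; exact: (measurable_diff mphi).
  rewrite lee_fin mulrDl; apply: ler_wpDl.
    by rewrite !mulr_ge0 ?expR_ge0 ?(ltW C0).
  rewrite -expRD -[leLHS]expR0 ler_expR subr_ge0 lerXn2r ?nnegrE ?divr_ge0 ?(ltW tau0)//.
  by rewrite ler_pM2r ?invr_gt0// ltW.
pose K := sigma * a * (tau + rho).
have K0 : 0 < K by rewrite !mulr_gt0// ltr_wpDr.
(* On [S] the form is [2 * K]-Lipschitz; [K] is the threshold of [frobenius_tail]. *)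
pose S := [set z : 'M[R]_(p, n) * 'M[R]_(p, n) |
  frobenius (A^T *m z.1 *m B) <= K /\ frobenius (A *m z.2 *m B^T) <= K].
have S0 : S !=set0.
  exists 0; rewrite /S/= !mulmx0 !mul0mx.
  have -> : frobenius (0 : 'M[R]_(p, n)) = 0.
    by apply/eqP; rewrite -sqrf_eq0 -mxdot_frobenius mxdot0l.
  by split; exact: ltW.
have lipS x y : S x -> S y -> phi x - phi y <= 2 * K * pair_norm (x - y).
  by move=> [_ hx] [hy _]; exact: bilinear_lipschitz.
have K20 : 0 < 2 * K by rewrite mulr_gt0.
have [g [gphi glip]] := lipschitz_extension (@pair_norm0 R p n)
  (@pair_norm_subr R p n) (@pair_normB_le R p n) (ltW K20) S0 lipS.
have mg : measurable_fun [set: T] (fun w => g (X w, Y w)).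
  have -> : (fun w => g (X w, Y w)) = (fun w => 2 * K * (g (X w, Y w) / (2 * K))).
    by apply/funext => w; rewrite mulrC divfK// gt_eqF.
  apply: measurable_funM => //.
  apply: (measurable_lipschitz (f := fun z => g z / (2 * K))) => // x y.
  by rewrite -mulrBl normrM normfV (gtr0_norm K20) ler_pdivrMr// mulrC.
have concX : lipschitz_concentrated P (@frobenius R p n) X
    (fun t => C * exp_decay sigma q%:R t).
  move=> f lip; apply: (conc (fun z => f z.1)) => x y.
  by apply: le_trans (lip _ _) _; rewrite /pair_norm le_max lexx.
have concY : lipschitz_concentrated P (@frobenius R p n) Y
    (fun t => C * exp_decay sigma q%:R t).
  move=> f lip; apply: (conc (fun z => f z.2)) => x y.
  by apply: le_trans (lip _ _) _; rewrite /pair_norm le_max lexx orbT.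
have BX := frobenius_tail q1 C1 s0 mX concX X0 a0 ABa tau0.
have BY : (P [set w | (K <= frobenius (A *m Y w *m B^T))%R] <=
    (2 * (C * expR (- (tau ^+ q))))%:E)%E.
  have := frobenius_tail (A := A^T) (B := B^T) q1 C1 s0 mY concY Y0 a0 _ tau0.
  by rewrite !frobenius_tr trmxK; apply.
rewrite -/rho -/K in BX.
set badX := [set w | _] in BX; set badY := [set w | _] in BY.
have mbX : measurable badX.
  by apply: measurable_le_set => //; exact: measurable_frobenius.
have mbY : measurable badY.
  by apply: measurable_le_set => //; exact: measurable_frobenius.
have t0 : 0 < sigma ^+ 2 * a * tau ^+ 2 by rewrite !mulr_gt0 ?exprn_gt0.
have tail := lipschitz_concentrated_scale s0 K20 t0 conc glip.
have Pbad : (P (badX `|` badY) <= (4 * (C * expR (- (tau ^+ q))))%:E)%E.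
  apply: le_trans (measureU2 _ mbX mbY) _.
  apply: le_trans (leeD BX BY) _.
  by rewrite -EFinD lee_fin; lra.
have eqW w : ~ (badX `|` badY) w -> phi (X w, Y w) = g (X w, Y w).
  move=> /not_orP[/negP nX /negP nY]; rewrite gphi//.
  by rewrite -!ltNge in nX nY; split; exact: ltW.
apply: le_trans (concentrated_of_truncation mphi mg (measurableU _ _ mbX mbY)
  eqW Pbad tail) _.
have tt : sigma ^+ 2 * a * tau ^+ 2 / (sigma * (2 * K)) =
    tau ^+ 2 / (2 * (tau + rho)).
  rewrite /K; field.
  by rewrite !gt_eqF// ltr_wpDr.
(* Since [rho <= tau], the quotient [tau ^+ 2 / (2 * (tau + rho))] is at least [tau / 4]. *)
have e1 : expR (- (sigma ^+ 2 * a * tau ^+ 2 / (sigma * (2 * K))) ^+ q) <=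
    expR (- (tau / 4) ^+ q).
  rewrite tt; apply: expR_pow_le; first by rewrite divr_ge0 ?(ltW tau0).
  by rewrite ler_pdivlMr ?mulr_gt0 ?ltr_wpDr//; nra.
have e2 : expR (- tau ^+ q) <= expR (- (tau / 4) ^+ q).
  by apply: expR_pow_le; [rewrite divr_ge0 ?(ltW tau0)|lra].
have := ler_wpM2l (ltW C0) e1; have := ler_wpM2l (ltW C0) e2.
rewrite lee_fin mulrDl.
have : 0 <= expR ((rho / 4) ^+ q) * expR (- (tau / 4) ^+ q).
  by rewrite mulr_ge0 ?expR_ge0.
by lra.
Qed.

(** * From an independent copy to the mean *)

(** The term [2 * K] comes from [recenter]; the exponential makes the bound at least 1 for [t] below
    [12 * D] in the next proof. *)
Definition mean_const (R : realType) (q : nat) (K : R) : R :=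
  2 * K + expR (Num.sqrt (6 * (K * moment_const R)) ^+ q).

(** The square root of [|W - W'|] has a tail in [v / s], so its second moment bounds the mean of
    [|W - W'|] by [D]. This yields integrability and a center [m] within [2 * D] of the mean;
    concentration around [m] is then moved to the mean. *)
Lemma concentrated_mean (R : realType) (d : measure_display)
    (T : measurableType d) (P : probability T R) (W : T -> R) (q : nat)
    (K s : R) :
  (1 <= q)%N -> 1 <= K -> 0 < s -> measurable_fun [set: T] W ->
  (forall v, 0 < v -> ((P \x P) [set w : T * T | (v ^+ 2 <= `|W w.1 - W w.2|)%R]
     <= (K * expR (- ((v / s) ^+ q)))%:E)%E) ->
  P.-integrable [set: T] (EFin \o W) /\
  forall t, 0 < t ->
    (P [set w | (t <= `|W w - \int[P]_w W w|)%R] <=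
       (mean_const q K * expR (- ((Num.sqrt (t / 2) / s) ^+ q)))%:E)%E.
Proof.
move=> q1 K1 s0 mW tail.
have K0 : 0 < K by apply: lt_le_trans K1.
pose D := K * moment_const R * s ^+ 2.
have D0 : 0 < D by rewrite !mulr_gt0 ?moment_const_gt0 ?exprn_gt0.
have mA : measurable_fun [set: T * T] (fun w => `|W w.1 - W w.2|).
  by apply: measurable_fun_norm; exact: measurable_diff.
have : (\int[P \x P]_w (`|W w.1 - W w.2|)%:E <= D%:E)%E.
  have -> : (\int[P \x P]_w (`|W w.1 - W w.2|)%:E =
      \int[P \x P]_w (Num.sqrt `|W w.1 - W w.2| ^+ 2)%:E)%E.
    by apply: eq_integral => w _; rewrite sqr_sqrtr.
  apply: (second_moment_of_tail (V := fun w => Num.sqrt `|W w.1 - W w.2|)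
      q1 K1 s0) => //.
  - apply: measurableT_comp => //.
    by apply: continuous_measurable_fun; exact: sqrt_continuous.
  - move=> v v0.
    have vE (x : R) : 0 <= x -> (v <= Num.sqrt x) = (v ^+ 2 <= x).
      move=> x0; rewrite -[in RHS](sqr_sqrtr x0) ler_pXn2r// nnegrE.
      - exact: ltW.
      - exact: sqrtr_ge0.
    under eq_set do rewrite vE//.
    exact: tail.
move=> /(integrable_of_diff mW D0)[m [Wi Wm]]; split => // t t0.
set E := \int[P]_w W w.
have mWm c : measurable_fun [set: T] (fun w => W w - c).
  exact: measurable_funB.
have mset c e : measurable [set w | (e <= `|W w - c|)%R].
  by apply: measurable_le_set => //; exact: measurable_fun_norm.
have Em : `|E - m| <= 2 * D.
  have ci : P.-integrable [set: T] (EFin \o cst m).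
    exact: finite_measure_integrable_cst.
  have dE : (\int[P]_w ((W w - m)%:E) = (E - m)%:E)%E.
    rewrite (_ : (fun w => (W w - m)%:E) = (fun w => (EFin \o W) w - (EFin \o cst m) w)%E)//.
    rewrite integralB// /= integral_cst_probability EFinB /E /Rintegral fineK//.
    exact: integrable_fin_num.
  rewrite -lee_fin -abse_EFin -dE; apply: le_trans Wm.
  apply: le_trans (le_abse_integral _ _ _) _ => //.
  exact/measurable_EFinP.
rewrite /mean_const.
have [tD|Dt] := ltP t (12 * D).
  apply: (@le_trans _ _ 1%E); first by apply: probability_le1.
  rewrite lee_fin mulrDl; apply: ler_wpDl.
    by rewrite !mulr_ge0 ?expR_ge0 ?(ltW K0).
  rewrite -expRD -[leLHS]expR0 ler_expR subr_ge0 lerXn2r ?nnegrE ?divr_ge0 ?sqrtr_ge0 ?(ltW s0)//.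
  rewrite ler_pdivrMr// -(@ler_pXn2r _ 2)// ?nnegrE ?mulr_ge0 ?sqrtr_ge0 ?(ltW s0)//.
  rewrite exprMn !sqr_sqrtr; last 2 first.
  - by rewrite !mulr_ge0 ?moment_const_ge0 ?(ltW K0).
  - by rewrite divr_ge0 ?(ltW t0).
  by rewrite /D in tD; lra.
(* The loss [6 * D] is the Markov radius [4 * D] plus the distance [2 * D] from [m] to the mean; as
   [12 * D <= t], at least [t / 2] remains. *)
have t60 : 0 < t - 6 * D by lra.
have half : (P [set w | (4 * D <= `|W w - m|)%R] <= (2^-1)%:E)%E.
  apply: (@markov_half _ _ _ _ (fun w => W w - m)) => //; first by rewrite mulr_gt0.
  by apply: le_trans Wm _; rewrite lee_fin; lra.
have := tail (Num.sqrt (t - 6 * D)); rewrite sqrtr_gt0 => /(_ t60).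
rewrite sqr_sqrtr ?(ltW t60)// => /(recenter mW half) h.
apply: (@le_trans _ _ (P [set w | (t - 6 * D + 4 * D <= `|W w - m|)%R])).
  apply: le_measure; rewrite ?inE//.
  move=> w /= tw; have := ler_distD m (W w) E.
  by rewrite (distrC m E); lra.
apply: le_trans h _; rewrite lee_fin [leRHS]mulrDl mulrA.
apply: ler_wpDr; first by rewrite mulr_ge0 ?expR_ge0.
rewrite ler_pM2l ?mulr_gt0//; apply: expR_pow_le.
  by rewrite divr_ge0 ?sqrtr_ge0 ?(ltW s0).
by rewrite ler_pM2r ?invr_gt0// ler_sqrt; lra.
Qed.

Lemma bilinear_const_ge1 (R : realType) (q : nat) (C : R) :
  1 <= C -> 1 <= bilinear_const q C.
Proof.
by move=> C1; have := expR_ge0 ((Num.sqrt (2 * C * moment_const R) / 4) ^+ q);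
  rewrite /bilinear_const; lra.
Qed.

Lemma mean_const_gt0 (R : realType) (q : nat) (K : R) :
  1 <= K -> 0 < mean_const q K.
Proof.
by move=> K1; have := expR_ge0 (Num.sqrt (6 * (K * moment_const R)) ^+ q);
  rewrite /mean_const; lra.
Qed.

Lemma powR_half (R : realType) (q : nat) (x : R) :
  0 <= x -> x `^ (q%:R / 2) = Num.sqrt x ^+ q.
Proof.
move=> x0; rewrite mulrC powRrM powR12_sqrt// powR_mulrn//.
Qed.

Lemma bilinear_concentrated_mean (R : realType) (d : measure_display)
    (T : measurableType d) (P : probability T R) (p n : nat)
    (X Y : T -> 'M[R]_(p, n)) (A : 'M[R]_p) (B : 'M[R]_n) (C sigma a : R)
    (q : nat) :
  (1 <= q)%N -> 1 <= C -> 0 < sigma -> random_matrix X -> random_matrix Y ->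
  lipschitz_concentrated P (@pair_norm R p n) (fun w => (X w, Y w))
    (fun t => C * exp_decay sigma q%:R t) ->
  has_expectation P X 0 -> has_expectation P Y 0 ->
  0 < a -> frobenius A * frobenius B <= a ->
  let W := fun w => mxdot B ((X w)^T *m A *m Y w) in
  P.-integrable [set: T] (EFin \o W) /\
  concentrated_around P W (\int[P]_w W w)
    (fun t => mean_const q (bilinear_const q C) *
              exp_decay (32 * a * sigma ^+ 2) (q%:R / 2) t).
Proof.
move=> q1 C1 s0 mX mY conc X0 Y0 a0 ABa W.
have WE w : W w = mxdot (A^T *m X w *m B) (Y w).
  by rewrite /W !mxdotE !trmx_mul trmxK !mulmxA.
have mW : measurable_fun [set: T] W.
  apply: measurable_mxdot; first exact: random_matrix_cst.
  apply: random_matrix_mul => //; apply: random_matrix_mul.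
  - exact: random_matrix_tr.
  - exact: random_matrix_cst.
(* With [v = tau * sigma * Num.sqrt a], the level [sigma ^+ 2 * a * tau ^+ 2] is [v ^+ 2] and
   [tau / 4] is [v / s]. *)
pose s := 4 * (sigma * Num.sqrt a).
have sa0 : 0 < sigma * Num.sqrt a by rewrite mulr_gt0// sqrtr_gt0.
have s_gt0 : 0 < s by rewrite mulr_gt0.
have a2 : a = Num.sqrt a ^+ 2 by rewrite sqr_sqrtr// ltW.
have tail v : 0 < v ->
    ((P \x P) [set w : T * T | (v ^+ 2 <= `|W w.1 - W w.2|)%R]
     <= (bilinear_const q C * expR (- ((v / s) ^+ q)))%:E)%E.
  move=> v0; have tau0 : 0 < v / (sigma * Num.sqrt a) by rewrite divr_gt0.
  have := bilinear_concentrated q1 C1 s0 mX mY conc X0 Y0 a0 ABa tau0.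
  have -> : sigma ^+ 2 * a * (v / (sigma * Num.sqrt a)) ^+ 2 = v ^+ 2.
    by rewrite {1}a2 -exprMn -exprMn mulrC divfK// gt_eqF.
  have -> : v / (sigma * Num.sqrt a) / 4 = v / s.
    by rewrite /s [in RHS]invfM mulrA mulrAC.
  by under eq_set do rewrite -!WE.
have [Wi Wc] := concentrated_mean q1 (bilinear_const_ge1 q C1) s_gt0 mW tail.
split=> // t t0; rewrite /exp_decay gt_eqF ?mulr_gt0 ?exprn_gt0//.
(* Here 32 is [2 * 4 ^+ 2]: the 2 from [t / 2], the 4 from [s]. *)
have -> : t / (32 * a * sigma ^+ 2) = (Num.sqrt (t / 2) / s) ^+ 2.
  rewrite exprMn exprVn sqr_sqrtr ?divr_ge0 ?(ltW t0)// /s !exprMn -a2.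
  by field; rewrite !gt_eqF.
rewrite powR_half ?sqr_ge0// sqrtr_sqr ger0_norm; first exact: Wc.
by rewrite divr_ge0 ?sqrtr_ge0 ?(ltW s_gt0).
Qed.

(** * Linear forms on matrices *)

Lemma mxdot_delta (R : realType) (m n : nat) (i : 'I_m) (j : 'I_n)
    (A : 'M[R]_(m, n)) : mxdot (delta_mx i j) A = A i j.
Proof.
rewrite /mxdot (bigD1 i)//= (bigD1 j)//= big1 => [|j' /negPf j'j]; last first.
  by rewrite mxE j'j andbF mul0r.
rewrite big1 => [|i' /negPf i'i]; first by rewrite mxE !eqxx mul1r !addr0.
by rewrite big1// => j' _; rewrite mxE i'i mul0r.
Qed.

Lemma frobenius_delta (R : realType) (m n : nat) (i : 'I_m) (j : 'I_n) :
  frobenius (delta_mx i j : 'M[R]_(m, n)) = 1.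
Proof.
apply/eqP; rewrite -(@eqrXn2 _ 2) ?frobenius_ge0//.
by rewrite -mxdot_frobenius mxdot_delta mxE !eqxx expr1n.
Qed.

Lemma scalar_mxdot (R : realType) (m n : nat) (u : {scalar 'M[R]_(m, n)})
    (A : 'M[R]_(m, n)) :
  u A = mxdot (\matrix_(i, j) u (delta_mx i j)) A.
Proof.
rewrite {1}(matrix_sum_delta A) raddf_sum; apply: eq_bigr => i _.
rewrite raddf_sum; apply: eq_bigr => j _.
by rewrite mxE mulrC; exact: linearZ.
Qed.

(** Evaluated at its own representing matrix [B], the form gives
    [frobenius B ^+ 2 <= frobenius B]. *)
Lemma frobenius_scalar_le1 (R : realType) (m n : nat)
    (u : {scalar 'M[R]_(m, n)}) :
  (forall z, `|u z| <= frobenius z) ->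
  frobenius (\matrix_(i, j) u (delta_mx i j)) <= 1.
Proof.
move=> u1; set B := \matrix_(_, _) _.
have := u1 B; rewrite scalar_mxdot -/B mxdot_frobenius ger0_norm ?sqr_ge0//.
have := frobenius_ge0 B; rewrite le_eqVlt => /predU1P[<- //|B0].
by rewrite expr2 -[leRHS]mulr1 ler_pM2l.
Qed.

Unset Implicit Arguments.

Theorem theorem2p30 (R : realType) (q : nat) (hq : (1 <= q)%N)
    (C : R) (hC : expR 1 <= C) :
  exists C' c : R, [/\ 0 < C', 0 < c &
    forall (p n : nat) (hp : (1 <= p)%N) (hn : (1 <= n)%N)
      (sigma : R) (hsigma : 0 < sigma)
      (d : measure_display) (T : measurableType d) (P : probability T R)
      (X Y : T -> 'M[R]_(p, n)) (A : 'M[R]_p),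
    random_matrix X -> random_matrix Y ->
    lipschitz_concentrated P (@pair_norm R p n) (fun w => (X w, Y w))
      (fun t => C * exp_decay sigma q%:R t) ->
    has_expectation P X 0 -> has_expectation P Y 0 ->
    exists M : 'M[R]_n,
      has_expectation P (fun w => (X w)^T *m A *m Y w) M /\
      linearly_concentrated P (@frobenius R n n)
        (fun w => (X w)^T *m A *m Y w) M
        (fun t =>
           C' * exp_decay
             (c * sigma ^+ 2 * frobenius A * (ln (p * n)%:R) `^ (q%:R^-1))
             q%:R t
         + C' * exp_decay (c * frobenius A * sigma ^+ 2) (q%:R / 2) t)].
Proof.
have C1 : 1 <= C by apply: le_trans hC; rewrite -[leLHS]expR0 ler_expR.
have K1 := bilinear_const_ge1 q C1.
set K := bilinear_const q C in K1.
have C'0 := mean_const_gt0 q K1.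
(* Every scale [s] is covered, including the value 0 that the logarithmic scale takes when
   [p * n = 1]. *)
have decay_ge0 s r t : 0 <= mean_const q K * exp_decay s r t.
  by rewrite mulr_ge0 ?(ltW C'0)// /exp_decay; case: ifP => // _; exact: expR_ge0.
exists (mean_const q K), 32; split => // p n _ _ sigma s0 d T P X Y A mX mY conc X0 Y0.
(* For [A = 0] both decay terms vanish, and the deviation event is empty because the product is
   constantly 0. *)
have [A0|A0] := eqVneq (frobenius A) 0.
  exists 0; rewrite (frobenius_eq0 A0).
  have E w : (X w)^T *m (0 : 'M[R]_p) *m Y w = 0 by rewrite mulmx0 mul0mx.
  under eq_fun do rewrite E.
  split => [i j|u _ t t0].
    rewrite !mxE; split; first exact: integrable0.
    by rewrite expectation_cst.
  rewrite (_ : [set w | _] = set0).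
    by rewrite measure0 lee_fin addr_ge0.
  apply/seteqP; split => w //=.
  by rewrite subrr normr0 leNgt t0.
have a0 : 0 < frobenius A by rewrite lt0r A0 frobenius_ge0.
have main (B : 'M[R]_n) : frobenius B <= 1 ->
    frobenius A * frobenius B <= frobenius A.
  by move=> B1; rewrite -[leRHS]mulr1 ler_pM2l.
have conc_mean B (B1 : frobenius B <= 1) := bilinear_concentrated_mean hq C1 s0
  mX mY conc X0 Y0 a0 (main B B1).
pose M : 'M[R]_n := \matrix_(i, j) \int[P]_w ((X w)^T *m A *m Y w) i j.
have ZM : has_expectation P (fun w => (X w)^T *m A *m Y w) M.
  (* An entry is the scalar product with a matrix unit, of norm 1, so its integrability is a case of
     the bilinear estimate. *)
  move=> i j; have := conc_mean (delta_mx i j).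
  rewrite frobenius_delta => /(_ (lexx _))[Zi _].
  have {}Zi : P.-integrable [set: T]
      (fun w => (((X w)^T *m A *m Y w) i j)%:E).
    by apply: eq_integrable Zi => // w _; rewrite /= mxdot_delta.
  split => //; rewrite mxE unlock /Rintegral fineK//.
  exact: integrable_fin_num.
exists M; split => // u u1 t t0.
set B := \matrix_(i, j) u (delta_mx i j).
have [_ /(_ t t0)] := conc_mean B (frobenius_scalar_le1 u1).
have [_ EB] := mxdot_expectation B ZM.
rewrite /Rintegral EB /= => h.
under eq_set do rewrite !scalar_mxdot.
(* The second term alone bounds the probability; the first is nonnegative and is added. *)
by apply: le_trans h _; rewrite lee_fin lerDr.
Qed.
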